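(* Any three-dimensional solvable subalgebra of $\mathfrak{sp}(4,\mathbb{C})$ consisting entirely of nilpotent elements must be equivalent to one of the following inequivalent subalgebras: $$\mathfrak{n}_{\mathfrak{p}},\qquad \langle X_{\beta},X_{\alpha+\beta},X_{\alpha+2\beta}\rangle,\qquad \langle X_{\beta}+X_{\alpha},X_{\alpha+\beta},X_{\alpha+2\beta}\rangle .$$
   Context: Let $J=\begin{pmatrix}0&0&1&0\\0&0&0&1\\-1&0&0&0\\0&-1&0&0\end{pmatrix}$. $\mathfrak{sp}(4,\mathbb{C})$ is the Lie algebra of $4\times4$ complex matrices $X$ with $JX^tJ=X$, and $Sp(4,\mathbb{C})=\{g\in GL(4,\mathbb{C}) : gJg^t=J\}$, acting on $\mathfrak{sp}(4,\mathbb{C})$ by conjugation $X\mapsto gXg^{-1}$. Elements are nilpotent if they are so as matrices. With $E_{ij}$ the matrix units, $X_\alpha=E_{24}$, $X_\beta=E_{12}-E_{43}$, $X_{\alpha+\beta}=E_{14}+E_{23}$, $X_{\alpha+2\beta}=E_{13}$. $\langle\,\cdot\,\rangle$ denotes the complex linear span, and $\mathfrak{n}_{\mathfrak{p}}=\langle X_\alpha,X_{\alpha+\beta},X_{\alpha+2\beta}\rangle$. Two subalgebras are equivalent if some $g\in Sp(4,\mathbb{C})$ conjugates one onto the other. *)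

(* Defs.v *)
From HB Require Import structures.
From mathcomp Require Import all_boot all_order all_algebra.
From mathcomp Require Import complex reals.

Set Implicit Arguments.
Unset Strict Implicit.
Unset Printing Implicit Defensive.

Import GRing.Theory.
Local Open Scope ring_scope.

Section Sp4.

Variable F : fieldType.
Implicit Types (X Y g : 'M[F]_4) (L M : {vspace 'M[F]_4}).

Definition J4 : 'M[F]_4 :=
  block_mx 0 1%:M (- 1%:M) 0 : 'M[F]_(2 + 2).

Definition sp4 : {pred 'M[F]_4} := [pred X | J4 *m X^T *m J4 == X].

Definition Sp4 : {pred 'M[F]_4} :=
  [pred g | (g \in unitmx) && (g *m J4 *m g^T == J4)].

Definition lie_bracket X Y : 'M[F]_4 := X *m Y - Y *m X.

Definition is_sp4_subalgebra L : Prop :=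
  {subset L <= sp4} /\ {in L &, forall X Y, lie_bracket X Y \in L}.

(* By bilinearity it is enough to bracket basis elements, as in the library's
   product of subspaces [prodv]; see [lie_derived_subP]. *)
Definition lie_derived L : {vspace 'M[F]_4} :=
  <<[seq lie_bracket X Y | X <- vbasis L, Y <- vbasis L]>>%VS.

Lemma lie_derived_subP L M :
  reflect {in L &, forall X Y, lie_bracket X Y \in M} (lie_derived L <= M)%VS.
Proof.
apply: (iffP span_subvP) => [sLM X Y LX LY|sLM Z /allpairsP[[X Y] /= [bX bY ->]]].
  rewrite (coord_vbasis LX) (coord_vbasis LY) /lie_bracket.
  rewrite mulmx_suml [in X in _ - X]mulmx_sumr -sumrB rpred_sum// => i _.
  rewrite mulmx_sumr mulmx_suml -sumrB rpred_sum// => j _.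
  rewrite -!scalemxAl -!scalemxAr !scalerA [X in _ - X *: _]mulrC -scalerBr.
  by apply/rpredZ/sLM/allpairs_f; rewrite mem_nth ?size_tuple.
by apply: sLM; apply: vbasis_mem.
Qed.

Definition lie_solvable L : Prop := exists n, iter n lie_derived L = 0%VS.

Definition nilpotent_mx X : Prop := exists k, X ^+ k = 0.

Definition conj_mx g : 'End('M[F]_4) := linfun (mulmxr (invmx g) \o mulmx g).

Lemma conj_mxE g X : conj_mx g X = g *m X *m invmx g.
Proof. by rewrite lfunE. Qed.

Definition Sp4_equiv L M : Prop :=
  exists2 g, g \in Sp4 & (conj_mx g @: L)%VS = M.

(* Matrix units with the usual indices 1, ..., 4; ordinals start at 0. *)
Definition E (i j : nat) : 'M[F]_4 := delta_mx (inord i.-1) (inord j.-1).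

Definition X_a : 'M[F]_4 := E 2 4.
Definition X_b : 'M[F]_4 := E 1 2 - E 4 3.
Definition X_ab : 'M[F]_4 := E 1 4 + E 2 3.
Definition X_a2b : 'M[F]_4 := E 1 3.

Definition n_p : {vspace 'M[F]_4} := <<[:: X_a; X_ab; X_a2b]>>%VS.
Definition n_b : {vspace 'M[F]_4} := <<[:: X_b; X_ab; X_a2b]>>%VS.
Definition n_ba : {vspace 'M[F]_4} := <<[:: (X_b + X_a)%R; X_ab; X_a2b]>>%VS.

End Sp4.

Arguments n_p {F}.
Arguments n_b {F}.
Arguments n_ba {F}.

(* Main.v *)
Require Import Defs.
From mathcomp Require Import all_boot all_order all_algebra.
From mathcomp Require Import complex reals.
From mathcomp Require Import ring.

(* Row vectors carry the form u J v^T, preserved by Sp(4) and for which sp(4) is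
   skew. By Lie's theorem L kills a row r3 and maps some r4 in r3^perp to <r3>;
   completing (r3, r4) to a symplectic basis conjugates L into the nilradical
   n = <X_a, X_b, X_ab, X_a2b> of a Borel subalgebra. The image of L in
   n / [n, n] is a line, since otherwise L would generate n; this line is <X_a>
   or <X_b + c X_a>, and the torus normalises c != 0 to c = 1. The algebra n_p
   is abelian while the other two are not, and X^3 = 0 on n_b but not on n_ba. *)

Set Implicit Arguments.
Unset Strict Implicit.
Unset Printing Implicit Defensive.

Import GRing.Theory.
Local Open Scope ring_scope.

Section Sp4Nilpotent.

Variable F : fieldType.
Implicit Types (X Y g : 'M[F]_4) (L K : {vspace 'M[F]_4}).

(** * Derived series, ideals of codimension one and Lie's theorem *)

Lemma lie_derivedS K L : (K <= L)%VS -> (lie_derived K <= lie_derived L)%VS.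
Proof.
move=> /subvP sKL; apply/lie_derived_subP => X Y KX KY.
by have /lie_derived_subP := subvv (lie_derived L); apply; apply: sKL.
Qed.

Lemma lie_solvableS K L : (K <= L)%VS -> lie_solvable L -> lie_solvable K.
Proof.
move=> sKL [n Ln]; exists n; apply/eqP; rewrite -subv0 -Ln.
by elim: n {Ln} => //= n IHn; apply: lie_derivedS.
Qed.

(** A perfect algebra has a constant derived series, which reaches zero only if the algebra is
    zero. *)
Lemma lie_solvable_derivedN L :
  lie_solvable L -> L != 0%VS -> lie_derived L != L.
Proof.
move=> [n Ln]; apply: contraNneq => dL; rewrite -Ln.
by elim: n {Ln} => //= n /eqP <-; rewrite dL.
Qed.

(** Meant for [D] = [L, L]: every subspace between [L, L] and L is an ideal. The vector [x] is
    picked in a complement of [D] in [L], and [K] is [D] plus a complement of [x] in that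
    complement. *)
Lemma hyperplane_over (vT : vectType F) (D L : {vspace vT}) :
    (D <= L)%VS -> D != L ->
  exists x (K : {vspace vT}),
    [/\ x \in L, (D <= K <= L)%VS, (\dim K < \dim L)%N & L = (<[x]> + K)%VS].
Proof.
move=> sDL nDL; pose C := (L :\: D)%VS; pose x := vpick C.
have sCL : (C <= L)%VS by apply: diffvSl.
have defL : (C + D)%VS = L.
  by rewrite addv_diff; apply/addv_idPl.
have nzC : C != 0%VS.
  by apply: contraNneq nDL => C0; rewrite -defL C0 add0v.
have Cx : x \in C := memv_pick C.
have defC : (<[x]> + (C :\: <[x]>) = C)%VS.
  by rewrite addvC addv_diff; apply/addv_idPl; rewrite -memvE.
exists x, ((C :\: <[x]>) + D)%VS; split.
- exact: subvP sCL _ Cx.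
- by rewrite addvSr subv_add sDL (subv_trans (diffvSl _ _) sCL).
- have dC := dimv_cap_compl C <[x]>.
  have dL := dimv_cap_compl L D.
  have := dimv_add_leqif (C :\: <[x]>)%VS D; case=> le1 _.
  apply: leq_ltn_trans le1 _.
  rewrite -dL -/C (capv_idPr sDL) addnC ltn_add2l -dC.
  rewrite (capv_idPr _) -?memvE// dim_vline vpick0 nzC.
  by rewrite add1n.
- by rewrite addvA defC defL.
Qed.

(* Lie's theorem in Engel form. Its induction runs through an ideal of
   codimension one, which exists because L is solvable. *)
Lemma lie_solvable_nilpotent_vector
    L (V : 'rV[F]_4 -> Prop) m (U : 'M[F]_(m, 4)) :
    {in L &, forall X Y, lie_bracket X Y \in L} -> lie_solvable L ->
    {in L, forall X, nilpotent_mx X} ->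
    {in L, forall X, stablemx U X} ->
    {in L, forall X v, V v -> V (v *m X)} ->
    (exists2 v, V v & ~~ (v <= U)%MS) ->
  exists2 v, V v /\ ~~ (v <= U)%MS & {in L, forall X, (v *m X <= U)%MS}.
Proof.
have [n] := ubnP (\dim L); elim: n L => // n IHn L.
rewrite ltnS => dL brL solL nilL stU stV exV.
have [L0|nzL] := eqVneq L 0%VS.
  case: exV => v Vv nUv; exists v => // X; rewrite L0 memv0 => /eqP->.
  by rewrite mulmx0 sub0mx.
have sDL : (lie_derived L <= L)%VS by apply/lie_derived_subP.
have [x [K [Lx /andP[sDK sKL] dK defL]]] :=
  hyperplane_over sDL (lie_solvable_derivedN solL nzL).
have {}sKL := subvP sKL.
have brK X Y : X \in L -> Y \in L -> lie_bracket X Y \in K.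
  by move=> LX LY; apply: (lie_derived_subP _ _ sDK).
have [|||||||w [Vw nUw] Kw] := IHn K.
- exact: leq_trans dK dL.
- by move=> X Y /sKL LX /sKL LY; apply: brK.
- by apply: lie_solvableS solL; apply/subvP.
- by move=> X /sKL; apply: nilL.
- by move=> X /sKL; apply: stU.
- by move=> X /sKL; apply: stV.
- exact: exV.
(* [K] sends every v = [w *m x ^+ j] into [U]: v x k = v [x, k] + v k x, where [x, k] lies in [K]
   and [x] preserves [U]. *)
have stW j : V (w *m x ^+ j) /\ {in K, forall k, (w *m x ^+ j *m k <= U)%MS}.
  elim: j => [|j [IHV IHK]]; first by rewrite expr0 mulmx1.
  have -> : w *m x ^+ j.+1 = w *m x ^+ j *m x by rewrite exprSr mulmxA.
  split=> [|k Kk]; first exact: stV.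
  have -> : w *m x ^+ j *m x *m k =
      w *m x ^+ j *m lie_bracket x k + w *m x ^+ j *m k *m x.
    by rewrite /lie_bracket mulmxBr !mulmxA subrK.
  rewrite addmx_sub ?IHK ?brK ?(sKL k)//.
  by apply: submx_trans (stU x Lx); apply/submxMr/IHK.
have exj : exists j, (w *m x ^+ j <= U)%MS.
  by have [j xj] := nilL x Lx; exists j; rewrite xj mulmx0 sub0mx.
(* The last [w *m x ^+ j] outside [U] is sent into [U] by [x] as well as by [K]. *)
case: (ex_minnP exj) => -[|j] Uj minj.
  by rewrite expr0 mulmx1 (negPf nUw) in Uj.
have [Vj Kj] := stW j; exists (w *m x ^+ j).
  by split=> //; apply/negP => /minj; rewrite ltnn.
move=> X; rewrite defL => /memv_addP[_ /vlineP[c ->] [k Kk ->]].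
have xj : (w *m x ^+ j *m x <= U)%MS by rewrite -mulmxA; move: Uj; rewrite exprSr.
by rewrite mulmxDr -scalemxAr addmx_sub ?Kj// scalemx_sub.
Qed.

(** * Explicit matrices and the symplectic form on row vectors *)

Definition mx4 (s : seq (seq F)) : 'M[F]_4 := \matrix_(i, j) nth 0 (nth [::] s i) j.

Lemma mx4_eta X :
  X = mx4 (mkseq (fun i => mkseq (fun j => X (inord i) (inord j)) 4) 4).
Proof. by apply/matrixP => i j; rewrite mxE !nth_mkseq ?inord_val. Qed.

Ltac mx4_ring :=
  apply/matrixP => -[[|[|[|[|?]]]] //= ?] [[|[|[|[|?]]]] //= ?];
  rewrite ?(mxE, big_ord_recl, big_ord0) /=; try ring.

Lemma J4E :
  J4 F = mx4 [:: [:: 0; 0; 1; 0]; [:: 0; 0; 0; 1];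
                 [:: -1; 0; 0; 0]; [:: 0; -1; 0; 0]].
Proof.
apply/matrixP => i j; rewrite /J4 !mxE.
by case: splitP => i' ->; rewrite !mxE; case: splitP => j' ->; rewrite !mxE;
  case: i' => -[|[|?]] //= ?; case: j' => -[|[|?]] //= ?; rewrite ?oppr0.
Qed.

Lemma J4_trmx : (J4 F)^T = - J4 F.
Proof. by rewrite J4E; mx4_ring. Qed.

Lemma J4_sqr : J4 F *m J4 F = - 1%:M.
Proof. by rewrite J4E; mx4_ring. Qed.

Definition sform (u v : 'rV[F]_4) : F := (u *m J4 F *m v^T) 0 0.

Lemma sformE (u v : 'rV[F]_4) :
  sform u v = u 0 (inord 0) * v 0 (inord 2) + u 0 (inord 1) * v 0 (inord 3)
            - u 0 (inord 2) * v 0 (inord 0) - u 0 (inord 3) * v 0 (inord 1).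
Proof.
have E4 (f : 'I_4 -> F) : \sum_i f i =
    f (inord 0) + f (inord 1) + f (inord 2) + f (inord 3).
  rewrite !big_ord_recl big_ord0 addr0 !addrA.
  by congr (f _ + f _ + f _ + f _); apply: val_inj; rewrite /= inordK.
by rewrite /sform J4E ?(mxE, E4) ?inordK //=; ring.
Qed.

Lemma sformC u v : sform u v = - sform v u.
Proof. by rewrite !sformE; ring. Qed.

Lemma sformv u : sform u u = 0.
Proof. by rewrite sformE; ring. Qed.

Lemma sformDl u v w : sform (u + v) w = sform u w + sform v w.
Proof. by rewrite /sform !mulmxDl mxE. Qed.

Lemma sformZl c u v : sform (c *: u) v = c * sform u v.
Proof. by rewrite /sform -!scalemxAl mxE. Qed.

(** Some column [c] of [cokermx v] is a linear functional that vanishes at [v] but not at [u]. Since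
    J^T J = 1, the form represents it by [(J4 F *m c)^T], which is then rescaled. *)
Lemma sform_separates (u v : 'rV[F]_4) :
  ~~ (u <= v)%MS -> exists2 r, sform r u = 1 & sform r v = 0.
Proof.
rewrite submxE => /rV0Pn[j nzj]; set c := col j (cokermx v).
have sc w : sform ((J4 F *m c)^T) w = (w *m c) 0 0.
  rewrite /sform trmx_mul J4_trmx mulmxN mulNmx -(mulmxA c^T) J4_sqr.
  by rewrite mulmxN mulmx1 !mulNmx opprK -trmx_mul mxE.
have cE (w : 'rV_4) : (w *m c) 0 0 = (w *m cokermx v) 0 j.
  by rewrite /c colE mulmxA -colE mxE.
have uc : (u *m c) 0 0 != 0 by rewrite cE.
exists (((u *m c) 0 0)^-1 *: (J4 F *m c)^T); rewrite sformZl sc ?mulVf//.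
by rewrite (cE v) mulmx_coker [X in _ * X]mxE mulr0.
Qed.

(** The orthogonal of [u] is the kernel of one functional, so its dimension is at least 3 and it
    cannot fit in the span of [u]. *)
Lemma sform_orthogonal_vector (u : 'rV[F]_4) :
  exists2 v, sform v u = 0 & ~~ (v <= u)%MS.
Proof.
pose A := J4 F *m u^T.
have : ~~ (kermx A <= u)%MS.
  apply/negP => /mxrankS; rewrite mxrank_ker.
  have := rank_leq_row u; have := rank_leq_col A.
  by case: (\rank A) => [|[|?]] // _; case: (\rank u) => [|[|?]].
case/row_subPn => i nu; exists (row i (kermx A)) => //.
by rewrite /sform -mulmxA -row_mul mulmx_ker !mxE.
Qed.

(** * The group Sp(4) and its action on sp(4) *)

Lemma sp4_mulJ X : X \in @sp4 F -> X *m J4 F = - (J4 F *m X^T).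
Proof.
by move=> /eqP {1}<-; rewrite -!mulmxA J4_sqr !mulmxN mulmx1.
Qed.

Lemma sform_sp4 X u v : X \in @sp4 F -> sform (u *m X) v = - sform u (v *m X).
Proof.
move=> spX; rewrite /sform -[u *m X *m _]mulmxA sp4_mulJ// trmx_mul.
by rewrite mulmxN mulNmx mxE !mulmxA.
Qed.

(** Invertibility comes from the relation itself: -J g^T J is a right inverse of [g]. *)
Lemma Sp4_of_form g : g *m J4 F *m g^T = J4 F -> g \in @Sp4 F.
Proof.
move=> gJ; rewrite inE gJ eqxx andbT.
have /mulmx1_unit[] // : g *m (- (J4 F *m g^T *m J4 F)) = 1%:M.
by rewrite mulmxN !mulmxA gJ J4_sqr opprK.
Qed.

Lemma symplectic_basis_mem_Sp4 (r : 'I_4 -> 'rV[F]_4) :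
    (forall i j, sform (r i) (r j) = J4 F i j) ->
  \matrix_i r i \in @Sp4 F.
Proof.
move=> rP; set g := \matrix_i r i.
apply/Sp4_of_form/matrixP => i j; rewrite -rP /sform -![r _](rowK r) -/g.
rewrite tr_row -row_mul [LHS]mxE [RHS]mxE; apply: eq_bigr => k _.
by rewrite [row _ _ _ _]mxE [col _ _ _ _]mxE.
Qed.

(** The relation g J g^T = J lets [g] pass through J: g^T J = J g^-1 and g J = J (g^-1)^T. These
    turn J (g X g^-1)^T J into g (J X^T J) g^-1. *)
Lemma conj_mx_sp4 g X : g \in @Sp4 F -> X \in @sp4 F -> conj_mx g X \in @sp4 F.
Proof.
rewrite inE => /andP[ug /eqP gJ] spX; rewrite inE conj_mxE; apply/eqP.
have Jg : J4 F *m g^T = invmx g *m J4 F.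
  by rewrite -{2}gJ !mulmxA mulVmx// mul1mx.
have {}Jg : g^T *m J4 F = J4 F *m invmx g.
  rewrite -[LHS]mul1mx -[1%:M]opprK -J4_sqr mulNmx -(mulmxA (J4 F)).
  by rewrite (mulmxA (J4 F) g^T) Jg -mulmxA J4_sqr !mulmxN mulmx1 opprK.
have gJ' : g *m J4 F = J4 F *m (invmx g)^T.
  by rewrite -{2}gJ -!mulmxA -trmx_mul mulVmx// trmx1 mulmx1.
rewrite !trmx_mul !mulmxA -gJ' -(mulmxA _ g^T) Jg.
by rewrite -[in RHS](eqP spX) !mulmxA.
Qed.

Lemma conj_mx_mul g X Y : g \in unitmx ->
  conj_mx g (X *m Y) = conj_mx g X *m conj_mx g Y.
Proof. by move=> ug; rewrite !conj_mxE !mulmxA mulmxKV. Qed.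

Lemma conj_mxM g h X : g \in unitmx -> h \in unitmx ->
  conj_mx (g *m h) X = conj_mx g (conj_mx h X).
Proof. by move=> ug uh; rewrite !conj_mxE [invmx _](invrM ug uh) !mulmxA. Qed.

Lemma conj_mx_inj g : g \in unitmx -> injective (conj_mx g).
Proof.
move=> ug; apply: (can_inj (g := conj_mx (invmx g))) => X.
by rewrite !conj_mxE invmxK !mulmxA mulVmx// mul1mx mulmxKV.
Qed.

(** * Root coordinates on the nilradical of the Borel subalgebra *)

Definition nilmx (a b p q : F) : 'M[F]_4 :=
  mx4 [:: [:: 0; b; q; p]; [:: 0; 0; p; a]; [:: 0; 0; 0; 0]; [:: 0; 0; - b; 0]].

Lemma nilmxE a b p q :
  nilmx a b p q = a *: X_a F + b *: X_b F + p *: X_ab F + q *: X_a2b F.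
Proof.
have EE i j : E F i j =
    \matrix_(k, l) ((k == inord i.-1) && (l == inord j.-1))%:R.
  by apply/matrixP => k l; rewrite !mxE.
by rewrite /X_a /X_b /X_ab /X_a2b !EE /nilmx; mx4_ring;
  rewrite -?val_eqE /= ?inordK //=; ring.
Qed.

Lemma nilmx0 : nilmx 0 0 0 0 = 0.
Proof. by rewrite nilmxE !scale0r !addr0. Qed.

Lemma nilmxD a b p q a' b' p' q' :
  nilmx a b p q + nilmx a' b' p' q' = nilmx (a + a') (b + b') (p + p') (q + q').
Proof. by rewrite /nilmx; mx4_ring. Qed.

Lemma nilmxZ c a b p q : c *: nilmx a b p q = nilmx (c * a) (c * b) (c * p) (c * q).
Proof. by rewrite /nilmx; mx4_ring. Qed.

Lemma nilmx_inj a b p q a' b' p' q' :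
  nilmx a b p q = nilmx a' b' p' q' -> [/\ a = a', b = b', p = p' & q = q'].
Proof.
move=> /matrixP eqN; split.
- by have := eqN (inord 1) (inord 3); rewrite !mxE !inordK.
- by have := eqN (inord 0) (inord 1); rewrite !mxE !inordK.
- by have := eqN (inord 0) (inord 3); rewrite !mxE !inordK.
- by have := eqN (inord 0) (inord 2); rewrite !mxE !inordK.
Qed.

(** The structure constants of n: [X_b, X_a] = X_ab, [X_b, X_ab] = 2 X_a2b, and all other brackets
    of root vectors vanish up to sign. The factor 2 is the source of the later assumption on the
    characteristic. *)
Lemma lie_bracket_nilmx a b p q a' b' p' q' :
  lie_bracket (nilmx a b p q) (nilmx a' b' p' q') =
  nilmx 0 0 (b * a' - b' * a) (2%:R * (b * p' - b' * p)).
Proof. by rewrite /lie_bracket /nilmx; mx4_ring. Qed.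

(** The cube detects whether both simple root coordinates are nonzero; this is the invariant
    separating [n_b] from [n_ba]. *)
Lemma nilmx_exp3 a b p q : nilmx a b p q ^+ 3 = nilmx 0 0 0 (- (b ^+ 2 * a)).
Proof.
have N2 : nilmx a b p q *m nilmx a b p q =
    mx4 [:: [:: 0; 0; 0; b * a]; [:: 0; 0; - (a * b); 0]; nseq 4 0; nseq 4 0].
  by rewrite /nilmx; mx4_ring.
rewrite !exprS expr0 mulr1 -!mulmxE N2 /nilmx.
by mx4_ring.
Qed.

Lemma J4_conj_trmx (a b c d e f g h i j k l m n o p : F) :
  J4 F *m (mx4 [:: [:: a; b; c; d]; [:: e; f; g; h];
                   [:: i; j; k; l]; [:: m; n; o; p]])^T *m J4 F =
  mx4 [:: [:: - k; - o; c; g]; [:: - l; - p; d; h];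
          [:: i; m; - a; - e]; [:: j; n; - b; - f]].
Proof.
rewrite -mulmxA.
have -> : (mx4 [:: [:: a; b; c; d]; [:: e; f; g; h];
                   [:: i; j; k; l]; [:: m; n; o; p]])^T *m J4 F =
    mx4 [:: [:: - i; - m; a; e]; [:: - j; - n; b; f];
            [:: - k; - o; c; g]; [:: - l; - p; d; h]].
  by rewrite J4E; mx4_ring.
by rewrite J4E; mx4_ring.
Qed.

Lemma nilmx_sp4 a b p q : nilmx a b p q \in @sp4 F.
Proof. by rewrite inE; apply/eqP; rewrite J4_conj_trmx /nilmx !oppr0 ?opprK. Qed.

(** In 2 by 2 blocks, an element of sp(4) is (A, B; C, -A^T) with B and C symmetric. The two row
    conditions force C = 0 and A strictly upper triangular. *)
Lemma sp4_nilmx X c :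
    X \in @sp4 F -> row (inord 2) X = 0 ->
    row (inord 3) X = c *: row (inord 2) 1%:M ->
  exists a b p q, X = nilmx a b p q.
Proof.
rewrite inE (mx4_eta X) /mkseq /= J4_conj_trmx.
(* The names follow the order in which the entries occur in J X^T J. *)
move: (X _ _) (X _ _) (X _ _) (X _ _) (X _ _) (X _ _) (X _ _) (X _ _)
      (X _ _) (X _ _) (X _ _) (X _ _) (X _ _) (X _ _) (X _ _) (X _ _).
move=> f b n j e a m i r p s l p' q o k /eqP/matrixP JX /rowP r2 /rowP r3.
have := (r2 (inord 0), r2 (inord 1), r2 (inord 2), r2 (inord 3)).
rewrite !mxE !inordK //= => -[[[i0 j0] k0] l0].
have := (r3 (inord 0), r3 (inord 1), r3 (inord 3)).
rewrite !mxE -!val_eqE /= !inordK //= !mulr0 => -[[m0 n0] s0].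
have := (JX (inord 0) (inord 0), JX (inord 1) (inord 0), JX (inord 1) (inord 1),
         JX (inord 1) (inord 2), JX (inord 3) (inord 2)).
rewrite !mxE !inordK //= => -[[[[<- <-] <-] <-] <-].
by exists r, b, p, q; rewrite i0 j0 k0 l0 m0 n0 s0 oppr0.
Qed.

(** * Three-dimensional subalgebras of the nilradical *)

Lemma mem_span3 (vT : vectType F) (x y z v : vT) :
  v \in <<[:: x; y; z]>>%VS <-> exists a b c, v = a *: x + b *: y + c *: z.
Proof.
rewrite !span_cons span_nil addv0; split.
  move=> /memv_addP[_ /vlineP[a ->] [w /memv_addP[_ /vlineP[b ->] wE] ->]].
  have [_ /vlineP[c ->] ->] := wE.
  by exists a, b, c; rewrite addrA.
move=> [a [b [c ->]]]; rewrite -addrA.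
by rewrite !memv_add// memvZ// memv_line.
Qed.

(** The lines other than <X_a> in n modulo <X_ab, X_a2b>, pulled back to n and parametrised by
    slope. *)
Definition n_line (c : F) : {vspace 'M[F]_4} :=
  <<[:: (X_b F + c *: X_a F)%R; X_ab F; X_a2b F]>>%VS.

Lemma n_bE : n_b = n_line 0.
Proof. by rewrite /n_line scale0r addr0. Qed.

Lemma n_baE : n_ba = n_line 1.
Proof. by rewrite /n_line scale1r. Qed.

Lemma mem_n_p X : X \in n_p <-> exists a p q, X = nilmx a 0 p q.
Proof.
rewrite mem_span3; split=> -[a [p [q ->]]]; exists a, p, q;
  by rewrite nilmxE scale0r addr0.
Qed.

Lemma mem_n_line (c : F) X :
  X \in n_line c <-> exists b p q, X = nilmx (b * c) b p q.
Proof.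
rewrite mem_span3; split=> -[b [p [q ->]]]; exists b, p, q;
  by rewrite nilmxE (scalerDr b (X_b F) (c *: X_a F)) scalerA [b *: _ + _]addrC.
Qed.

Lemma dim_nilmx L : (forall a b p q, nilmx a b p q \in L) -> (4 <= \dim L)%N.
Proof.
move=> LN.
pose s := [tuple nilmx (1 : F) 0 0 0; nilmx (0 : F) 1 0 0;
                 nilmx (0 : F) 0 1 0; nilmx (0 : F) 0 0 1].
have /eqP : free s.
  apply/freeP => k; rewrite !big_ord_recl big_ord0 addr0 /= !nilmxZ !nilmxD.
  rewrite -nilmx0 => /nilmx_inj.
  rewrite !(mulr0, mulr1, add0r, addr0) => -[k0 k1 k2 k3].
  case=> -[|[|[|[|//]]]] lti.
  - by rewrite -[RHS]k0; congr k; apply: val_inj.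
  - by rewrite -[RHS]k1; congr k; apply: val_inj.
  - by rewrite -[RHS]k2; congr k; apply: val_inj.
  - by rewrite -[RHS]k3; congr k; apply: val_inj.
move=> dim4; apply: (@leq_trans (\dim <<s>>)); first by rewrite dim4.
apply/dimvS/span_subvP => X; rewrite !inE => /or4P[]/eqP->; exact: LN.
Qed.

Lemma nilmx_subalgebra_classes L :
    2%:R != 0 :> F ->
    {in L &, forall X Y, lie_bracket X Y \in L} -> \dim L = 3%N ->
    {in L, forall X, exists a b p q, X = nilmx a b p q} ->
  L = n_p \/ exists c, L = n_line c.
Proof.
move=> nz2 brL dL LN.
(* One inclusion suffices, since a span of three vectors has dimension at most 3. *)
have eqL x y z : (L <= <<[:: x; y; z]>>)%VS -> L = <<[:: x; y; z]>>%VS.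
  by move=> sL; apply/eqP; rewrite eqEdim sL dL (dim_span [:: x; y; z]).
have [/eqL|/subvPn[X0 LX0 X0p]] := boolP (L <= n_p)%VS; first by left.
have [a [b [p [q X0E]]]] := LN _ LX0; rewrite X0E in LX0 X0p.
have nzb : b != 0.
  by apply: contraNneq X0p => ->; apply/mem_n_p; exists a, p, q.
(* Normalise the X_b coordinate to 1; the X_a coordinate is then the slope [c]. *)
have := memvZ b^-1 LX0; rewrite nilmxZ mulVf//.
set c := b^-1 * a; set p1 := _ * p; set q1 := _ * q => LX.
right; exists c; apply: eqL; apply: contraT => /subvPn[Y LY Yc].
have [a' [b' [p' [q' YE]]]] := LN _ LY; rewrite YE in LY Yc.
(* If Y lies off the line, X_b + ... and d X_a + ... generate all of n. *)
pose d := a' - b' * c.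
have nzd : d != 0.
  apply: contraNneq Yc => /eqP; rewrite subr_eq0 => /eqP->.
  by apply/mem_n_line; exists b', p', q'.
(* Subtracting b' X from Y clears the X_b coordinate. Two brackets with X then give d X_ab + q3
   X_a2b and 2d X_a2b. *)
have := memvD LY (memvZ (- b') LX); rewrite nilmxZ nilmxD.
rewrite mulr1 subrr mulNr -/d.
set p2 := p' + _; set q2 := q' + _ => LZ.
have := brL _ _ LX LZ; rewrite lie_bracket_nilmx !mul1r !mul0r !subr0.
set q3 := 2%:R * _ => LT.
have := brL _ _ LX LT; rewrite lie_bracket_nilmx !mul1r !mul0r !subr0 => LV.
have nz2d : 2%:R * d != 0 by rewrite mulf_neq0.
(* The root vectors enter L from the centre outwards: X_a2b, then X_ab, X_a and finally X_b, each
   time correcting by those already obtained. *)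
have Lq t : nilmx 0 0 0 t \in L.
  by have := memvZ (t / (2%:R * d)) LV; rewrite nilmxZ !mulr0 divfK.
have Lpq s t : nilmx 0 0 s t \in L.
  have := memvD (memvZ (s / d) LT) (Lq (t - s / d * q3)).
  by rewrite nilmxZ nilmxD !mulr0 divfK// !addr0 addrC subrK.
have Lapq r s t : nilmx r 0 s t \in L.
  have := memvD (memvZ (r / d) LZ) (Lpq (s - r / d * p2) (t - r / d * q2)).
  by rewrite nilmxZ nilmxD !mulr0 divfK// !addr0 ![_ + (_ - _)]addrC !subrK.
suff /dim_nilmx : forall r t s u, nilmx r t s u \in L by rewrite dL.
move=> r t s u.
have := memvD (memvZ t LX) (Lapq (r - t * c) (s - t * p1) (u - t * q1)).
by rewrite nilmxZ nilmxD mulr1 addr0 ![_ + (_ - _)]addrC !subrK.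
Qed.

(** * Conjugation into the nilradical and normalisation by the torus *)

Lemma Sp4_unit g : g \in @Sp4 F -> g \in unitmx.
Proof. by case/andP. Qed.

Lemma Sp4M g h : g \in @Sp4 F -> h \in @Sp4 F -> g *m h \in @Sp4 F.
Proof.
rewrite !inE => /andP[ug /eqP gJ] /andP[uh /eqP hJ].
by rewrite unitmx_mul ug uh trmx_mul !mulmxA -(mulmxA g h) -(mulmxA g) hJ gJ eqxx.
Qed.

Lemma dim_conj_mx g L : g \in unitmx -> \dim (conj_mx g @: L) = \dim L.
Proof.
move=> ug; apply: limg_dim_eq; apply/eqP; rewrite -subv0.
apply: subv_trans (capvSr _ _) _; rewrite subv0.
by apply/lker0P; apply: conj_mx_inj.
Qed.

Lemma Sp4_equiv_trans L K (M : {vspace 'M[F]_4}) :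
  Sp4_equiv L K -> Sp4_equiv K M -> Sp4_equiv L M.
Proof.
move=> [g Gg <-] [h Gh <-]; exists (h *m g); first exact: Sp4M.
rewrite -limg_comp; congr (_ @: _)%VS; apply/lfunP => X.
by rewrite comp_lfunE conj_mxM ?Sp4_unit.
Qed.

Lemma Sp4_conj_nilmx L :
    is_sp4_subalgebra L -> lie_solvable L -> {in L, forall X, nilpotent_mx X} ->
  exists2 g, g \in @Sp4 F &
    {in L, forall X, exists a b p q, conj_mx g X = nilmx a b p q}.
Proof.
move=> [spL brL] solL nilL.
(* With [U] = 0 and no side condition, this gives a common null row. *)
have [|||r3 [_ nz3] r3L] :=
    lie_solvable_nilpotent_vector (V := fun=> True) (U := 0 : 'M_4) brL solL nilL.
- by move=> X _; rewrite mul0mx.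
- by [].
- exists (delta_mx 0 0 : 'rV_4) => //; apply: contraNN (oner_neq0 F).
  by rewrite submx0 => /eqP/rowP/(_ 0); rewrite !mxE !eqxx => /eqP.
have {}r3L : {in L, forall X, r3 *m X = 0}.
  by move=> X LX; apply/eqP; rewrite -submx0 r3L.
have [|||r4 [r43 n43] r4L] :=
    lie_solvable_nilpotent_vector (V := fun v => sform v r3 = 0) (U := r3)
      brL solL nilL.
- by move=> X LX; rewrite r3L// sub0mx.
(* The orthogonal of [r3] is stable because X is skew for the form and kills [r3]. *)
- move=> X LX v _; rewrite (sform_sp4 _ _ (spL X LX)) r3L//.
  by rewrite /sform trmx0 mulmx0 mxE oppr0.
- by have [v ? ?] := sform_orthogonal_vector r3; exists v.
have n34 : ~~ (r3 <= r4)%MS.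
  apply: contra n43 => /sub_rVP[c r3E]; rewrite r3E eqmx_scale//.
  by apply: contraNneq nz3 => c0; rewrite r3E c0 scale0r sub0mx.
(* [r2] and [s] are dual to [r4] and [r3]. Adding a multiple of [r4] to [s] makes it orthogonal to
   [r2] without disturbing its other pairings, because [r4] is orthogonal to [r3] and to itself. *)
have [r2 r24 r23] := sform_separates n43.
have [s s3 s4] := sform_separates n34.
pose r1 := s + sform s r2 *: r4.
have r13 : sform r1 r3 = 1 by rewrite sformDl sformZl s3 r43 mulr0 addr0.
have r14 : sform r1 r4 = 0 by rewrite sformDl sformZl s4 sformv mulr0 addr0.
have r12 : sform r1 r2 = 0.
  by rewrite sformDl sformZl [sform r4 _]sformC r24 mulrN1 subrr.
pose r (i : 'I_4) := nth 0 [:: r1; r2; r3; r4] i.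
have Gg : \matrix_i r i \in @Sp4 F.
  apply: symplectic_basis_mem_Sp4 => i j; rewrite J4E mxE /r.
  case: i => -[|[|[|[|//]]]] ? /=; case: j => -[|[|[|[|//]]]] ? /=;
  by rewrite ?sformv// 1?sformC ?r13 ?r14 ?r12 ?r24 ?r23 ?r43 ?oppr0 //;
    rewrite sformC ?r13 ?r14 ?r12 ?r24 ?r23 ?r43 ?oppr0.
exists (\matrix_i r i) => // X LX; set g := \matrix_i r i in Gg *.
have ug := Sp4_unit Gg.
(* The last two rows of the conjugate are the coordinates of r3 X = 0 and r4 X = c r3 in the basis
   [r]. *)
have rowM i : row i (conj_mx g X) = r i *m X *m invmx g.
  by rewrite conj_mxE !row_mul rowK.
have /sub_rVP[c r4X] := r4L X LX.
apply: (sp4_nilmx (c := c)); first exact: conj_mx_sp4 (spL X LX).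
  by rewrite rowM /r inordK//= r3L// mul0mx.
rewrite rowM /r inordK//= r4X -scalemxAl -(mulmxV ug) row_mul rowK.
by rewrite /r inordK.
Qed.

Lemma Sp4_equiv_n_line (c : F) : c != 0 -> Sp4_equiv (n_line c) n_ba.
Proof.
move=> nzc.
(* This torus element fixes X_a and multiplies X_b by [c], so it carries X_b + c X_a to c (X_b +
   X_a). *)
pose t := mx4 [:: [:: c; 0; 0; 0]; [:: 0; 1; 0; 0];
               [:: 0; 0; c^-1; 0]; [:: 0; 0; 0; 1]].
have tJ : t *m J4 F *m t^T = J4 F.
  have -> : t *m J4 F =
      mx4 [:: [:: 0; 0; c; 0]; [:: 0; 0; 0; 1];
              [:: - c^-1; 0; 0; 0]; [:: 0; -1; 0; 0]].
    by rewrite J4E /t; mx4_ring.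
  by rewrite J4E /t; mx4_ring; field.
have Gt := Sp4_of_form tJ; have ut := Sp4_unit Gt.
have conjE a b p q : conj_mx t (nilmx a b p q) =
    nilmx a (c * b) (c * p) (c ^+ 2 * q).
  rewrite conj_mxE; apply: (canLR (mulmxK ut)).
  by rewrite /nilmx /t; mx4_ring; field.
exists t => //; rewrite n_baE; apply/vspaceP => X; apply/idP/idP.
  move=> /memv_imgP[_ /mem_n_line[b [p [q ->]]] ->].
  rewrite conjE mulrC; apply/mem_n_line; exists (c * b), (c * p), (c ^+ 2 * q).
  by rewrite mulr1.
move=> /mem_n_line[b [p [q ->]]]; apply/memv_imgP.
exists (nilmx (b / c * c) (b / c) (p / c) (q / c ^+ 2)).
  by apply/mem_n_line; exists (b / c), (p / c), (q / c ^+ 2).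
by rewrite conjE !divfK// ![_ * (_ / _)]mulrC !divfK ?expf_neq0// mulr1.
Qed.

(** * Inequivalence of the three algebras *)

Lemma n_p_comm X Y : X \in @n_p F -> Y \in @n_p F -> X *m Y = Y *m X.
Proof.
move=> /mem_n_p[a [p [q ->]]] /mem_n_p[a' [p' [q' ->]]].
apply/eqP; rewrite -subr_eq0 -/(lie_bracket _ _) lie_bracket_nilmx.
by rewrite !mul0r subrr mulr0 nilmx0.
Qed.

Lemma n_p_line_inequiv (c : F) : 2%:R != 0 :> F -> ~ Sp4_equiv n_p (n_line c).
Proof.
move=> nz2 [g Gg eqL]; have ug := Sp4_unit Gg.
have comm X Y : X \in n_line c -> Y \in n_line c -> X *m Y = Y *m X.
  rewrite -eqL => /memv_imgP[X' nX ->] /memv_imgP[Y' nY ->].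
  by rewrite -!conj_mx_mul// n_p_comm.
(* The pair X_b + c X_a and X_ab, whose bracket is 2 X_a2b; the unreduced products match the form in
   [mem_n_line]. *)
have := comm (nilmx (1 * c) 1 0 0) (nilmx (0 * c) 0 1 0).
have -> : nilmx (1 * c) 1 0 0 \in n_line c by apply/mem_n_line; exists 1, 0, 0.
have -> : nilmx (0 * c) 0 1 0 \in n_line c by apply/mem_n_line; exists 0, 1, 0.
move=> /(_ isT isT)/eqP; rewrite -subr_eq0 -/(lie_bracket _ _) lie_bracket_nilmx.
rewrite -nilmx0 => /eqP/nilmx_inj[_ _ _ /eqP].
by rewrite !mul0r mulr1 subr0 mulr1 (negPf nz2).
Qed.

Lemma conj_mx_exp g X n : g \in unitmx -> conj_mx g (X ^+ n) = conj_mx g X ^+ n.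
Proof.
move=> ug; elim: n => [|n IHn]; first by rewrite !expr0 conj_mxE mulmx1 mulmxV.
by rewrite !exprS -!mulmxE conj_mx_mul// IHn.
Qed.

Lemma n_b_ba_inequiv : ~ Sp4_equiv (@n_b F) n_ba.
Proof.
move=> [g Gg eqL]; have ug := Sp4_unit Gg.
(* X_b + X_a has cube -X_a2b, while its preimage in [n_b] would have cube zero. *)
have : nilmx (1 * 1) 1 0 0 \in @n_ba F.
  by rewrite n_baE; apply/mem_n_line; exists 1, 0, 0.
rewrite -eqL => /memv_imgP[X]; rewrite n_bE => /mem_n_line[b [p [q ->]]].
move=> /(congr1 (fun Y => Y ^+ 3)); rewrite -conj_mx_exp// !nilmx_exp3 !mulr0 oppr0.
rewrite nilmx0 linear0 -nilmx0 => /nilmx_inj[_ _ _ /eqP].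
by rewrite expr1n !mulr1 oppr_eq0 oner_eq0.
Qed.

(** * Closure under the bracket, and the classification *)

Lemma n_p_subalgebra : is_sp4_subalgebra (@n_p F).
Proof.
split=> [X /mem_n_p[a [p [q ->]]]|X Y nX nY]; first exact: nilmx_sp4.
by rewrite /lie_bracket n_p_comm// subrr mem0v.
Qed.

Lemma n_line_subalgebra (c : F) : is_sp4_subalgebra (n_line c).
Proof.
split=> [X /mem_n_line[b [p [q ->]]]|X Y]; first exact: nilmx_sp4.
move=> /mem_n_line[b [p [q ->]]] /mem_n_line[b' [p' [q' ->]]].
rewrite lie_bracket_nilmx; apply/mem_n_line.
(* The X_ab coordinate of the bracket cancels because both (a, b) parts are proportional to (c, 1);
   only X_a2b survives. *)
exists 0, 0, (2%:R * (b * p' - b' * p)).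
by rewrite mul0r; congr nilmx; ring.
Qed.

Lemma nilpotent_subalgebra_classes L :
    2%:R != 0 :> F ->
    is_sp4_subalgebra L -> \dim L = 3%N -> lie_solvable L ->
    {in L, forall X, nilpotent_mx X} ->
  Sp4_equiv L n_p \/ Sp4_equiv L n_b \/ Sp4_equiv L n_ba.
Proof.
move=> nz2 saL dL solL nilL.
have [g Gg gL] := Sp4_conj_nilmx saL solL nilL; have ug := Sp4_unit Gg.
have eqL : Sp4_equiv L (conj_mx g @: L) by exists g.
have [|||eqK|[c eqK]] := nilmx_subalgebra_classes (L := (conj_mx g @: L)%VS) nz2.
- move=> _ _ /memv_imgP[X LX ->] /memv_imgP[Y LY ->].
  rewrite /lie_bracket -!conj_mx_mul// -linearB memv_img//.
  by case: saL => _; apply.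
- by rewrite dim_conj_mx.
- by move=> _ /memv_imgP[X LX ->]; apply: gL.
- by left; rewrite -eqK.
right; have [c0|nzc] := eqVneq c 0; first by left; rewrite n_bE -c0 -eqK.
right; apply: Sp4_equiv_trans eqL _; rewrite eqK.
exact: Sp4_equiv_n_line.
Qed.

End Sp4Nilpotent.

Theorem theorem7p9 (R : realType) :
  (forall L : {vspace 'M[R[i]]_4},
      is_sp4_subalgebra L -> \dim L = 3%N -> lie_solvable L ->
      {in L, forall X, nilpotent_mx X} ->
      Sp4_equiv L n_p \/ Sp4_equiv L n_b \/ Sp4_equiv L n_ba) /\
  [/\ is_sp4_subalgebra (@n_p R[i]), is_sp4_subalgebra (@n_b R[i]) &
      is_sp4_subalgebra (@n_ba R[i])] /\
  [/\ ~ Sp4_equiv (@n_p R[i]) n_b, ~ Sp4_equiv (@n_p R[i]) n_ba &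
      ~ Sp4_equiv (@n_b R[i]) n_ba].
Proof.
have nz2 : 2%:R != 0 :> R[i] by rewrite Num.Theory.pnatr_eq0.
split; [by move=> L; apply: nilpotent_subalgebra_classes | split; split].
- exact: n_p_subalgebra.
- by rewrite n_bE; apply: n_line_subalgebra.
- by rewrite n_baE; apply: n_line_subalgebra.
- by rewrite n_bE; apply: n_p_line_inequiv.
- by rewrite n_baE; apply: n_p_line_inequiv.
- exact: n_b_ba_inequiv.
Qed.
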